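(* Let $f\in\mathcal F$ be nonzero with $f^\ast=-f$ (so $\ker f^\ast=\ker f$). Then $\langle\alpha,\beta\rangle_f=\langle\beta,\alpha\rangle_f$ for all $\alpha,\beta\in\ker f$.
   Context: Let $p$ be a prime, $q$ a power of $p$, and $C$ an algebraically closed field containing $\mathbb F_q$, complete with respect to a non-archimedean absolute value. $\mathcal F$ is the set of formal sums $f=\sum_{n\in\mathbb Z}a_n\tau^n$ ($a_n\in C$) such that $f(z)=\sum_na_nz^{q^n}$ converges for all $z\in C$; it is a ring under termwise addition and composition $(\sum a_i\tau^i)\circ(\sum b_j\tau^j)=\sum_n(\sum_{i+j=n}a_ib_j^{q^i})\tau^n$ (composition of maps), with $c\in C$ identified with multiplication by $c$. $\ker f=\{z\in C:f(z)=0\}$. The adjoint is $f^\ast=\sum_na_n^{1/q^n}\tau^{-n}$. For nonzero $f$ and $\alpha\in\ker f$, $g_\alpha\in\mathcal F$ is the unique element with $f\circ\alpha=g_\alpha\circ(1-\tau)$, and $\langle\alpha,\beta\rangle_f=g_\alpha^\ast(\beta)\in\mathbb F_q$ for $\beta\in\ker f^\ast$. *)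

(* Defs.v *)
From HB Require Import structures.
From mathcomp Require Import all_boot all_order all_algebra.
From mathcomp Require Import all_classical all_reals.
From mathcomp Require Import topology normedtype sequences.

Set Implicit Arguments.
Unset Strict Implicit.
Unset Printing Implicit Defensive.

Import Order.TTheory GRing.Theory Num.Theory.
Import numFieldNormedType.Exports.

Local Open Scope classical_set_scope.
Local Open Scope ring_scope.

(* The trivial absolute value is not excluded. *)
Record nonarch_abs (R : realType) (C : fieldType) (N : C -> R) : Prop :=
  NonarchAbs {
    nonarch_abs_ge0 : forall x, 0 <= N x;
    nonarch_abs_eq0 : forall x, N x = 0 <-> x = 0;
    nonarch_absM : forall x y, N (x * y) = N x * N y;
    nonarch_absD : forall x y, N (x + y) <= Num.max (N x) (N y)
  }.

Definition abs_cvg (R : realType) (C : fieldType) (N : C -> R)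
    (u : nat -> C) (l : C) : Prop :=
  N (u n - l) @[n --> \oo] --> (0 : R).

Definition abs_cauchy (R : realType) (C : fieldType) (N : C -> R)
    (u : nat -> C) : Prop :=
  forall e : R, 0 < e -> exists n0 : nat, forall m n : nat,
    (n0 <= m)%N -> (n0 <= n)%N -> N (u m - u n) < e.

Definition abs_complete (R : realType) (C : fieldType) (N : C -> R) : Prop :=
  forall u : nat -> C, abs_cauchy N u -> exists l : C, abs_cvg N u l.

(* A series indexed by the integers converges when both its nonnegative and its
   negative half do. *)
Definition zsums_to (R : realType) (C : fieldType) (N : C -> R)
    (u : int -> C) (l : C) : Prop :=
  exists l1 l2 : C,
    [/\ abs_cvg N (series (fun n : nat => u n%:Z)) l1,
        abs_cvg N (series (fun n : nat => u (- n.+1%:Z))) l2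
      & l = l1 + l2].

Definition zsum (R : realType) (C : fieldType) (N : C -> R) (u : int -> C) : C :=
  xget 0 [set l | zsums_to N u l].

(* x ^ (q ^ n) for an integer exponent n. For n < 0 this is the (q ^ -n)-th root
   of x, which exists and is unique when C is algebraically closed of
   characteristic p and q is a power of p. *)
Definition qpow (C : fieldType) (q : nat) (n : int) (x : C) : C :=
  match n with
  | Posz m => x ^+ (q ^ m)
  | Negz m => xget 0 [set y | y ^+ (q ^ m.+1) = x]
  end.

(* A formal sum \sum_n a_n tau^n is represented by its coefficients
   a : int -> C. *)
Definition feval (R : realType) (C : fieldType) (N : C -> R) (q : nat)
    (a : int -> C) (z : C) : C :=
  zsum N (fun n => a n * qpow q n z).

Definition calF (R : realType) (C : fieldType) (N : C -> R) (q : nat) :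
    set (int -> C) :=
  [set a | forall z : C, exists l : C,
             zsums_to N (fun n => a n * qpow q n z) l].

Definition fcomp (R : realType) (C : fieldType) (N : C -> R) (q : nat)
    (a b : int -> C) : int -> C :=
  fun n => zsum N (fun i => a i * qpow q i (b (n - i))).

Definition fconst (C : fieldType) (c : C) : int -> C :=
  fun n => if n == 0 then c else 0.

Definition ftau (C : fieldType) : int -> C :=
  fun n => if n == 1 then 1 else 0.

Definition fker (R : realType) (C : fieldType) (N : C -> R) (q : nat)
    (a : int -> C) : set C :=
  [set z | feval N q a z = 0].

(* The coefficient of tau^m in \sum_n a_n^(1/q^n) tau^(-n): take n = - m. *)
Definition fadj (C : fieldType) (q : nat) (a : int -> C) : int -> C :=
  fun m => qpow q m (a (- m)).

(* The unique g in calF with f \o alpha = g \o (1 - tau). *)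
Definition fquot (R : realType) (C : fieldType) (N : C -> R) (q : nat)
    (f : int -> C) (alpha : C) : int -> C :=
  xget (fun=> 0)
    [set g | calF N q g /\
             fcomp N q f (fconst alpha) =
             fcomp N q g (fconst 1 \- @ftau C)].

(* The value lies in the copy of F_q in C; it is kept as an element of C. *)
Definition fpairing (R : realType) (C : fieldType) (N : C -> R) (q : nat)
    (f : int -> C) (alpha beta : C) : C :=
  feval N q (fadj q (fquot N q f alpha)) beta.

(* Main.v *)
Require Import Defs.
From HB Require Import structures.
From mathcomp Require Import all_boot all_order all_algebra.
From mathcomp Require Import all_classical all_reals.
From mathcomp Require Import topology normedtype sequences.
From mathcomp Require Import finfield ring lra zify.

Set Implicit Arguments.
Unset Strict Implicit.
Unset Printing Implicit Defensive.

Import Order.TTheory GRing.Theory Num.Theory.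
Import numFieldNormedType.Exports.

Local Open Scope classical_set_scope.
Local Open Scope ring_scope.

(** Write [f = \sum_n a_n tau^n] and [g = g_alpha]. Comparing coefficients,
    [g_n - g_(n-1) = a_n alpha^(q^n)], so that
    [g_n = \sum_(i <= n) a_i alpha^(q^i) = - \sum_(i > n) a_i alpha^(q^i)], and
    [<alpha, beta>_f = \sum_n (g_n beta)^(q^-n)]. Expand [g_n] by its second
    expression for [n >= 0] and by its first one for [n < 0]. This choice makes
    each of the two double series converge unconditionally (using the same
    expression for all [n] would not). The relation [f^* = - f] identifies the
    part [n < 0] for [(alpha, beta)] with the part [n >= 0] for [(beta, alpha)]
    summed in the other order, so exchanging the summations gives the
    symmetry. *)

(** Bernoulli's inequality. It serves in [calF_small] to find a point of [C] whose absolute value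
    dominates given constants. *)
Lemma expr_unbounded (R : realType) (x b : R) :
  1 < x -> exists k : nat, b <= x ^+ k.
Proof.
move=> x1.
have bern (k : nat) : 1 + k%:R * (x - 1) <= x ^+ k.
  elim: k => [|k IH]; first by rewrite mul0r addr0 expr0.
  rewrite exprS -natr1; have kge0 : 0 <= k%:R :> R by [].
  have : x * (1 + k%:R * (x - 1)) <= x * x ^+ k by rewrite ler_pM2l //; lra.
  apply: le_trans; rewrite -subr_ge0.
  by rewrite [leRHS](_ : _ = k%:R * (x - 1) ^+ 2); [rewrite mulr_ge0 // sqr_ge0 | ring].
exists (Num.trunc (b / (x - 1))).+1; apply: le_trans (bern _).
have : b / (x - 1) < (Num.trunc (b / (x - 1))).+1%:R by exact: truncnS_gt.
by rewrite ltr_pdivrMr ?subr_gt0 // => h; lra.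
Qed.

(** * Series in a non-archimedean valued field *)

Section NonarchimedeanSeries.
Context {R : realType} {C : fieldType} {N : C -> R} (N_abs : nonarch_abs N).

Lemma nabs_ge0 x : 0 <= N x. Proof. exact: nonarch_abs_ge0. Qed.

Lemma nabs0 : N 0 = 0. Proof. exact/(nonarch_abs_eq0 N_abs). Qed.

Lemma nabsM x y : N (x * y) = N x * N y. Proof. exact: nonarch_absM. Qed.

Lemma nabs1 : N 1 = 1.
Proof.
have /eqP := nabsM 1 1; rewrite mulr1 -subr_eq0 -{1}[N 1]mulr1 -mulrBr mulf_eq0.
case/orP => [/eqP/(nonarch_abs_eq0 N_abs)/eqP|]; first by rewrite oner_eq0.
by rewrite subr_eq0 => /eqP.
Qed.

Lemma nabsX x n : N (x ^+ n) = N x ^+ n.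
Proof. by elim: n => [|n IH]; rewrite ?expr0 ?nabs1 // !exprS nabsM IH. Qed.

Lemma nabsN x : N (- x) = N x.
Proof.
apply/eqP; rewrite -(@eqrXn2 _ 2) ?nabs_ge0 //.
by rewrite -!nabsX sqrrN.
Qed.

Lemma nabsB x y : N (x - y) = N (y - x).
Proof. by rewrite -nabsN opprB. Qed.

Lemma nabsD_le x y e : N x <= e -> N y <= e -> N (x + y) <= e.
Proof.
move=> xe ye; apply: le_trans (nonarch_absD N_abs x y) _.
by rewrite ge_max xe ye.
Qed.

Lemma nabsB_le x y e : N x <= e -> N y <= e -> N (x - y) <= e.
Proof. by move=> xe ye; apply: nabsD_le; rewrite ?nabsN. Qed.

Lemma nabs_sum_le (I : Type) (r : seq I) (P : pred I) (F : I -> C) e :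
  0 <= e -> (forall i, P i -> N (F i) <= e) -> N (\sum_(i <- r | P i) F i) <= e.
Proof.
move=> e0 Fe; apply: (big_ind (fun x => N x <= e)) => //; first by rewrite nabs0.
by move=> x y; exact: nabsD_le.
Qed.

Lemma abs_cvgP (u : nat -> C) l : abs_cvg N u l <->
  forall e, 0 < e -> exists n0 : nat, forall n, (n0 <= n)%N -> N (u n - l) <= e.
Proof.
split=> [/cvgrPdist_le cu e e0|cu].
  have [n0 _ Hn0] := cu e e0; exists n0 => n n0n.
  by have := Hn0 n n0n; rewrite /= sub0r normrN ger0_norm // nabs_ge0.
apply/cvgrPdist_le => e e0; have [n0 Hn0] := cu e e0.
exists n0 => // n n0n /=.
by rewrite sub0r normrN ger0_norm ?nabs_ge0 // Hn0.
Qed.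

Lemma eq_abs_cvg (u v : nat -> C) l :
  u =1 v -> abs_cvg N u l -> abs_cvg N v l.
Proof. by move=> /funext ->. Qed.

Lemma eq_abs_cvg_series (u v : nat -> C) l :
  u =1 v -> abs_cvg N (series u) l -> abs_cvg N (series v) l.
Proof. by move=> /funext ->. Qed.

Lemma abs_cvg_cst (c : C) : abs_cvg N (fun=> c) c.
Proof. by apply/abs_cvgP => e e0; exists 0%N => n _; rewrite subrr nabs0 ltW. Qed.

Lemma abs_cvg_unique (u : nat -> C) l l' :
  abs_cvg N u l -> abs_cvg N u l' -> l = l'.
Proof.
move=> /abs_cvgP ul /abs_cvgP ul'; apply/eqP; rewrite -subr_eq0; apply/eqP.
apply/(nonarch_abs_eq0 N_abs)/eqP; rewrite eq_le nabs_ge0 andbT.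
apply/ler_addgt0Pr => e e0; rewrite add0r.
have [n Hn] := ul e e0; have [n' Hn'] := ul' e e0.
have -> : l - l' = (u (maxn n n') - l') - (u (maxn n n') - l) by ring.
apply: nabsB_le.
  by rewrite Hn' // leq_maxr.
by rewrite Hn // leq_maxl.
Qed.

Lemma abs_cvgD {u v : nat -> C} {l l'} :
  abs_cvg N u l -> abs_cvg N v l' -> abs_cvg N (fun n => u n + v n) (l + l').
Proof.
move=> /abs_cvgP ul /abs_cvgP vl'; apply/abs_cvgP => e e0.
have [n Hn] := ul e e0; have [n' Hn'] := vl' e e0.
exists (maxn n n') => k; rewrite geq_max => /andP[nk n'k].
by rewrite opprD addrACA; apply: nabsD_le; [exact: Hn | exact: Hn'].
Qed.

Lemma abs_cvgMr {u : nat -> C} {l} c :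
  abs_cvg N u l -> abs_cvg N (fun n => u n * c) (l * c).
Proof.
move=> /abs_cvgP ul; apply/abs_cvgP => e e0.
have c1 : 0 < N c + 1 by have := nabs_ge0 c; lra.
have [n0 Hn] := ul (e / (N c + 1)) (divr_gt0 e0 c1).
exists n0 => n /Hn; rewrite -mulrBl nabsM ler_pdivlMr // => h.
by apply: le_trans h; rewrite ler_wpM2l ?nabs_ge0 // lerDl.
Qed.

Lemma abs_cvgN {u : nat -> C} {l} :
  abs_cvg N u l -> abs_cvg N (fun n => - u n) (- l).
Proof.
move=> /(abs_cvgMr (- 1)); rewrite mulrN1.
by under [X in abs_cvg _ X]funext do rewrite mulrN1.
Qed.

Lemma abs_cvg_shift (u : nat -> C) l k :
  abs_cvg N (fun n => u (n + k)%N) l <-> abs_cvg N u l.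
Proof.
split=> /abs_cvgP ul; apply/abs_cvgP => e /ul[n0 Hn].
  exists (n0 + k)%N => n n0n.
  have kn : (k <= n)%N by apply: leq_trans n0n; exact: leq_addl.
  by rewrite -(subnK kn); apply: Hn; rewrite -(leq_add2r k) subnK.
by exists n0 => n n0n; apply: Hn; rewrite (leq_trans n0n) // leq_addr.
Qed.

Lemma abs_cvg_le (u : nat -> C) l e :
  abs_cvg N u l -> (exists n0 : nat, forall n, (n0 <= n)%N -> N (u n) <= e) -> N l <= e.
Proof.
move=> /abs_cvgP ul [n0 Hn0].
apply/ler_addgt0Pr => d d0; have [n1 Hn1] := ul d d0.
rewrite -[l](subrK (u (maxn n0 n1))) addrC.
have e0 : 0 <= e by apply: le_trans (nabs_ge0 _) (Hn0 n0 (leqnn _)).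
apply: nabsD_le.
  by apply: le_trans (Hn0 _ (leq_maxl _ _)) _; lra.
by rewrite nabsB; apply: le_trans (Hn1 _ (leq_maxr _ _)) _; lra.
Qed.

Lemma abs_cvg_dist (u v : nat -> C) l :
  abs_cvg N u l -> abs_cvg N (fun n => v n - u n) 0 -> abs_cvg N v l.
Proof.
move=> ul /abs_cvgD /(_ ul); rewrite add0r.
by under [X in abs_cvg _ X]funext do rewrite subrK.
Qed.

Lemma abs_cvg_term (u : nat -> C) l : abs_cvg N (series u) l -> abs_cvg N u 0.
Proof.
move=> ul; have ul1 : abs_cvg N (fun n => series u (n + 1)%N) l by apply/abs_cvg_shift.
have := abs_cvgD ul1 (abs_cvgN ul); rewrite subrr.
under [X in abs_cvg _ X]funext => n do rewrite addn1 seriesSr addrAC subrr add0r.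
by [].
Qed.

Lemma series_subE (u : nat -> C) m n : (m <= n)%N ->
  series u n - series u m = \sum_(m <= i < n) u i.
Proof. by move=> mn; rewrite sub_series mn. Qed.

Lemma seriesMr (u : nat -> C) c m :
  series u m * c = series (fun i => u i * c) m.
Proof. by rewrite /series /= mulr_suml. Qed.

(** By the ultrametric inequality a finite block is no larger than its largest term, and this passes
    to the limit. *)
Lemma series_tail_le (u : nat -> C) l e m : abs_cvg N (series u) l ->
  (forall i, (m <= i)%N -> N (u i) <= e) -> N (l - series u m) <= e.
Proof.
move=> ul ue; have e0 : 0 <= e := le_trans (nabs_ge0 _) (ue m (leqnn m)).
apply: (abs_cvg_le (abs_cvgD ul (abs_cvg_cst (- series u m)))).
exists m => n mn; rewrite series_subE // big_seq_cond; apply: nabs_sum_le => // i.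
by rewrite andbT mem_index_iota => /andP[/ue].
Qed.

Section Complete.
Context (N_complete : abs_complete N).

(** The ultrametric inequality makes the partial sums Cauchy as soon as the terms tend to 0. *)
Lemma abs_cvg_series (u : nat -> C) : abs_cvg N u 0 -> exists l, abs_cvg N (series u) l.
Proof.
move=> /abs_cvgP u0; apply: N_complete => e e0.
(* Halving [e] turns weak bounds into the strict one of [abs_cauchy]. *)
have e20 : 0 < e / 2 by lra.
have [n0 Hn0] := u0 _ e20.
exists n0 => m n n0m n0n.
have bnd k : (n0 <= k)%N -> N (series u k - series u n0) <= e / 2.
  move=> n0k; rewrite series_subE // big_seq_cond; apply: nabs_sum_le => [|i]; first exact: ltW.
  by rewrite andbT mem_index_iota => /andP[/Hn0]; rewrite subr0.
apply: le_lt_trans (_ : _ <= e / 2) _; last by lra.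
have -> : series u m - series u n =
  (series u m - series u n0) - (series u n - series u n0) by ring.
by apply: nabsB_le; exact: bnd.
Qed.

(** Since [A n l] is small outside a finite set, row and column remainders are uniformly small, so
    both partial sums of order [M] are close to the sum over the [M] by [M] square. *)
Lemma series_fubini (A : nat -> nat -> C) (r c : nat -> C) :
  (forall e, 0 < e -> exists K : nat, forall n l, (K <= n + l)%N -> N (A n l) <= e) ->
  (forall n, abs_cvg N (series (A n)) (r n)) ->
  (forall l, abs_cvg N (series (fun n => A n l)) (c l)) ->
  exists s, abs_cvg N (series r) s /\ abs_cvg N (series c) s.
Proof.
move=> A0 Ar Ac.
have rows0 (B : nat -> nat -> C) (b : nat -> C) :
    (forall e, 0 < e -> exists K : nat, forall n l, (K <= n + l)%N -> N (B n l) <= e) ->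
    (forall n, abs_cvg N (series (B n)) (b n)) ->
    forall e, 0 < e -> exists K : nat, forall n l, (K <= n + l)%N ->
      N (b n - series (B n) l) <= e.
  move=> B0 Bb e /B0[K HK]; exists K => n l Knl.
  apply: series_tail_le => // i li; apply: HK.
  by rewrite (leq_trans Knl) // leq_add2l.
have rA := rows0 _ _ A0 Ar.
have cA : forall e, 0 < e -> exists K : nat, forall n l, (K <= n + l)%N ->
      N (c n - series (A^~ n) l) <= e.
  apply: rows0 Ac => e /A0[K HK]; exists K => n l Knl; apply: HK.
  by rewrite addnC.
(* The remainder of a row after 0 terms is the whole row sum. *)
have r0 : abs_cvg N r 0.
  apply/abs_cvgP => e /rA[K HK]; exists K => n Kn.
  by have := HK n 0%N; rewrite addn0 /series /= big_geq //; apply.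
have [s rs] := abs_cvg_series r0; exists s; split => //.
apply: abs_cvg_dist rs _; apply/abs_cvgP => e e0.
have [K HK] := rA e e0; have [K' HK'] := cA e e0.
exists (maxn K K') => M; rewrite geq_max => /andP[KM K'M]; rewrite subr0.
pose S := \sum_(0 <= n < M) \sum_(0 <= l < M) A n l.
have rS : N (series r M - S) <= e.
  rewrite /series /S /= -sumrB; apply: nabs_sum_le => [|n _]; first exact: ltW.
  by apply: HK; rewrite (leq_trans KM) // leq_addl.
have cS : N (series c M - S) <= e.
  rewrite /series /S /= exchange_big /= -sumrB.
  apply: nabs_sum_le => [|n _]; first exact: ltW.
  by apply: HK'; rewrite (leq_trans K'M) // leq_addl.
have -> : series c M - series r M = (series c M - S) - (series r M - S) by ring.
exact: nabsB_le.
Qed.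

End Complete.
End NonarchimedeanSeries.

(** * Sums indexed by the integers *)

Section IntegerSeries.
Context {R : realType} {C : fieldType} {N : C -> R} (N_abs : nonarch_abs N).

Lemma eq_zsums_to (u v : int -> C) l :
  u =1 v -> zsums_to N u l -> zsums_to N v l.
Proof. by move=> /funext ->. Qed.

Lemma zsums_to_unique (u : int -> C) l l' :
  zsums_to N u l -> zsums_to N u l' -> l = l'.
Proof.
move=> [l1 [l2 [ul1 ul2 ->]]] [l1' [l2' [ul1' ul2' ->]]].
by rewrite (abs_cvg_unique N_abs ul1 ul1') (abs_cvg_unique N_abs ul2 ul2').
Qed.

Lemma zsumE (u : int -> C) l : zsums_to N u l -> zsum N u = l.
Proof. by move=> ul; apply: xget_unique => // l' /zsums_to_unique; exact. Qed.

Lemma zsums_toD (u v : int -> C) l l' :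
  zsums_to N u l -> zsums_to N v l' -> zsums_to N (fun i => u i + v i) (l + l').
Proof.
move=> [l1 [l2 [ul1 ul2 ->]]] [l1' [l2' [ul1' ul2' ->]]].
exists (l1 + l1'), (l2 + l2'); split; last by rewrite addrACA.
  have := abs_cvgD N_abs ul1 ul1'; apply: eq_abs_cvg => n.
  by rewrite /series /= big_split.
have := abs_cvgD N_abs ul2 ul2'; apply: eq_abs_cvg => n.
by rewrite /series /= big_split.
Qed.

Lemma series_delta (m : nat) (c : C) :
  abs_cvg N (series (fun k => if k == m then c else 0)) c.
Proof.
apply/(abs_cvgP N_abs) => e e0; exists m.+1 => n mn.
rewrite /series /= (bigD1_seq m) ?mem_index_iota ?iota_uniq //= eqxx big1.
  by rewrite addr0 subrr nabs0 // ltW.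
by move=> i /negPf ->.
Qed.

Lemma series0 : abs_cvg N (series (fun=> 0 : C)) 0.
Proof.
apply/(abs_cvgP N_abs) => e e0; exists 0%N => n _.
by rewrite /series /= big1 // subrr nabs0 // ltW.
Qed.

Lemma zsums_to_delta (n : int) (c : C) :
  zsums_to N (fun i => if i == n then c else 0) c.
Proof.
case: n => m.
  exists c, 0; split; last by rewrite addr0.
    have := series_delta m c; apply: eq_abs_cvg_series => k.
    by rewrite eqz_nat.
  have := series0; apply: eq_abs_cvg_series => k.
  by case: eqP => //; lia.
exists 0, c; split; last by rewrite add0r.
  have := series0; apply: eq_abs_cvg_series => k.
  by case: eqP => //; lia.
have := series_delta m c; apply: eq_abs_cvg_series => k.
by congr (if _ then _ else _); lia.
Qed.

(* The term of index 0 is moved from the nonnegative half to the other one. *)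
Lemma zsums_to_shift (u : int -> C) s1 s2 :
  abs_cvg N (series (fun n : nat => u n.+1%:Z)) s1 ->
  abs_cvg N (series (fun n : nat => u (- n%:Z))) s2 -> zsums_to N u (s1 + s2).
Proof.
move=> us1 us2; exists (u 0 + s1), (s2 - u 0); split; last by ring.
  apply/(abs_cvg_shift N_abs _ _ 1).
  have := abs_cvgD N_abs (abs_cvg_cst N_abs (u 0)) us1; apply: eq_abs_cvg => n.
  by rewrite addn1 /series /= big_nat_recl.
have {}us2 := iffRL (abs_cvg_shift N_abs _ _ 1) us2.
have := abs_cvgD N_abs us2 (abs_cvg_cst N_abs (- u 0)); apply: eq_abs_cvg => n.
by rewrite addn1 /series /= big_nat_recl // oppr0 addrC addKr.
Qed.

Lemma zsums_to_null (u : int -> C) l : zsums_to N u l ->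
  abs_cvg N (fun n : nat => u n%:Z) 0 /\ abs_cvg N (fun n : nat => u (- n%:Z)) 0.
Proof.
move=> [l1 [l2 [/(abs_cvg_term N_abs) ul1 /(abs_cvg_term N_abs) ul2 _]]].
split=> //; apply/(abs_cvg_shift N_abs _ _ 1).
by move: ul2; apply: eq_abs_cvg => n; rewrite addn1.
Qed.

Lemma null_zsums_to (N_complete : abs_complete N) (u : int -> C) :
  abs_cvg N (fun n : nat => u n%:Z) 0 -> abs_cvg N (fun n : nat => u (- n%:Z)) 0 ->
  exists l, zsums_to N u l.
Proof.
move=> /(abs_cvg_series N_abs N_complete)[l1 ul1].
move=> /(iffRL (abs_cvg_shift N_abs _ _ 1)) u2.
have [l2 ul2] := abs_cvg_series N_abs N_complete u2.
exists (l1 + l2), l1, l2; split=> //.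
by move: ul2; apply: eq_abs_cvg_series => n; rewrite addn1.
Qed.

End IntegerSeries.

(** * The maps x -> x^(q^n) for integer n *)

Section QPower.
Context {C : closedFieldType} {q : nat} (q_gt1 : (1 < q)%N)
  (q_pchar : ([pchar C]).-nat q).

Lemma pnat_expq j : ([pchar C]).-nat (q ^ j)%N.
Proof. by rewrite pnatX q_pchar. Qed.

Lemma expq_gt0 j : (0 < q ^ j)%N.
Proof. by rewrite expn_gt0 ltnW. Qed.

(** These powers are additive in characteristic p, and a field has no nonzero nilpotents. *)
Lemma expr_expq_inj j : injective (fun x : C => x ^+ (q ^ j)).
Proof.
move=> x y /= /eqP; rewrite -subr_eq0 -exprNn_pchar ?pnat_expq //.
by rewrite -exprDn_pchar ?pnat_expq // expf_eq0 expq_gt0 subr_eq0 => /eqP.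
Qed.

(** With n = i - j, an identity for [qpow q n] can be checked after raising to the power q^j, where
    only natural exponents remain and positive and negative n need no separate treatment. *)
Lemma int_subn (n : int) : exists i j : nat, n = i%:Z - j%:Z.
Proof. by case: n => m; [exists m, 0%N | exists 0%N, m.+1]; lia. Qed.

Lemma qpow_expq (n : int) (i j : nat) (x : C) : n = i%:Z - j%:Z ->
  qpow q n x ^+ (q ^ j) = x ^+ (q ^ i).
Proof.
case: n => m nij.
  by rewrite /= -exprM -expnD; congr (_ ^+ (_ ^ _)%N); lia.
have : exists y : C, y ^+ (q ^ m.+1) = x.
  (* A root of X^(q^(m+1)) - x, so that the default value of [xget] is not taken. *)
  have [y] := @solve_monicpoly C (q ^ m.+1)%N (fun i => if i == 0%N then x else 0) (expq_gt0 _).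
  have := expq_gt0 m.+1; case: (q ^ m.+1)%N => // d _ yx; exists y.
  by rewrite yx big_ord_recl /= mulr1 big1 ?addr0 // => l _; rewrite mul0r.
move=> /(xgetPex 0); rewrite /= => yx.
have -> : j = (m.+1 + i)%N by lia.
by rewrite expnD exprM yx.
Qed.

Lemma qpow_eq (n : int) (i j : nat) (x y : C) : n = i%:Z - j%:Z ->
  y ^+ (q ^ j) = x ^+ (q ^ i) -> qpow q n x = y.
Proof. by move=> /(@qpow_expq _ _ _ x) <- /expr_expq_inj. Qed.

Lemma qpowM n (x y : C) : qpow q n (x * y) = qpow q n x * qpow q n y.
Proof.
have [i [j nij]] := int_subn n; apply: (qpow_eq nij).
by rewrite !exprMn !(qpow_expq _ nij).
Qed.

Lemma qpowD n (x y : C) : qpow q n (x + y) = qpow q n x + qpow q n y.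
Proof.
have [i [j nij]] := int_subn n; apply: (qpow_eq nij).
by rewrite !exprDn_pchar ?pnat_expq // !(qpow_expq _ nij).
Qed.

Lemma qpow0 n : qpow q n (0 : C) = 0.
Proof. by apply: (@addrI _ (qpow q n 0)); rewrite -qpowD !addr0. Qed.

Lemma qpow1 n : qpow q n (1 : C) = 1.
Proof. by have [i [j nij]] := int_subn n; apply: (qpow_eq nij); rewrite !expr1n. Qed.

Lemma qpowN n (x : C) : qpow q n (- x) = - qpow q n x.
Proof. by apply: (@addrI _ (qpow q n x)); rewrite -qpowD !subrr qpow0. Qed.

Lemma qpow_qpow m n (x : C) : qpow q m (qpow q n x) = qpow q (m + n) x.
Proof.
have [i [j nij]] := int_subn n; have [i' [j' mij]] := int_subn m.
have mnij : m + n = (i + i')%N%:Z - (j + j')%N%:Z by lia.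
apply/esym/(qpow_eq mnij); rewrite [in LHS]addnC expnD exprM (qpow_expq _ mij).
by rewrite exprAC (qpow_expq _ nij) expnD exprM.
Qed.

Lemma qpow_series n (u : nat -> C) m :
  qpow q n (series u m) = series (fun i => qpow q n (u i)) m.
Proof. by rewrite /series /= (big_morph (qpow q n) (qpowD n) (qpow0 n)). Qed.

Section Absolute.
Context {R : realType} {N : C -> R} (N_abs : nonarch_abs N).

Lemma nabs_qpow n (i j : nat) (x : C) : n = i%:Z - j%:Z ->
  N (qpow q n x) ^+ (q ^ j) = N x ^+ (q ^ i).
Proof. by move=> nij; rewrite -!(nabsX N_abs) (qpow_expq _ nij). Qed.

Lemma abs_cvg_qpow n (u : nat -> C) l :
  abs_cvg N u l -> abs_cvg N (fun k => qpow q n (u k)) (qpow q n l).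
Proof.
move=> /(abs_cvgP N_abs) ul; apply/(abs_cvgP N_abs) => e e0.
have [i [j nij]] := int_subn n.
(* The bound 1 makes the q^i-th power only shrink the distance; the bound e^(q^j) then allows taking
   q^j-th roots. *)
have d0 : 0 < Num.min 1 (e ^+ (q ^ j)) by rewrite lt_min ltr01 exprn_gt0.
have [k0 Hk0] := ul _ d0; exists k0 => k /Hk0; rewrite le_min => /andP[u1 ue].
rewrite -qpowN -qpowD -(@ler_pXn2r _ (q ^ j)) ?expq_gt0 ?nnegrE ?nabs_ge0 //; last exact: ltW.
by rewrite (nabs_qpow _ nij); apply: le_trans ue; rewrite ler_iXnr ?expq_gt0 ?nabs_ge0.
Qed.

Lemma nabs_qroot_le (n : nat) (x : C) : N (qpow q (- n%:Z) x) <= Num.max 1 (N x).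
Proof.
have nE : - n%:Z = 0%N%:Z - n%:Z by lia.
have := nabs_qpow x nE; rewrite expn0 expr1 => <-.
rewrite le_max; case: leP => //= /ltW h.
by rewrite ler_eXnr // expq_gt0.
Qed.

Lemma fcomp_fconst (a : int -> C) c :
  fcomp N q a (fconst c) = fun n => a n * qpow q n c.
Proof.
apply/funext => n; apply: (zsumE N_abs).
have := zsums_to_delta N_abs n (a n * qpow q n c); apply: eq_zsums_to => i.
rewrite /fconst subr_eq0 [n == i]eq_sym.
by case: eqP => [-> //|_]; rewrite qpow0 mulr0.
Qed.

(** Only i = n and i = n - 1 contribute. With [fcomp_fconst], the equation defining [fquot] becomes
    a difference equation on coefficients. *)
Lemma fcomp_1subtau (a : int -> C) :
  fcomp N q a (fconst 1 \- @ftau C) = fun n => a n - a (n - 1).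
Proof.
apply/funext => n; apply: (zsumE N_abs).
have := zsums_toD N_abs (zsums_to_delta N_abs n (a n))
  (zsums_to_delta N_abs (n - 1) (- a (n - 1))); apply: eq_zsums_to => i.
rewrite /fconst /ftau /= qpowD qpowN mulrBr.
congr (_ + _).
  rewrite subr_eq0 [n == i]eq_sym; case: eqP => [->|_]; first by rewrite qpow1 mulr1.
  by rewrite qpow0 mulr0.
rewrite (_ : (n - i == 1) = (i == n - 1)); last by apply/eqP/eqP; lia.
case: eqP => [->|_]; first by rewrite qpow1 mulr1.
by rewrite qpow0 mulr0 oppr0.
Qed.

End Absolute.
End QPower.

(** * The quotient by 1 - tau and coefficient estimates *)

Section Pairing.
Context {C : closedFieldType} {q : nat} (q_gt1 : (1 < q)%N)
  (q_pchar : ([pchar C]).-nat q).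
Context {R : realType} {N : C -> R} (N_abs : nonarch_abs N)
  (N_complete : abs_complete N).

(** Convergence at z = 1, where every z^(q^n) is 1. *)
Lemma calF_null (a : int -> C) : calF N q a ->
  abs_cvg N (fun n : nat => a n%:Z) 0 /\ abs_cvg N (fun n : nat => a (- n%:Z)) 0.
Proof.
move=> /(_ 1)[l /(zsums_to_null N_abs)[a1 a2]].
by split; [move: a1 | move: a2]; apply: eq_abs_cvg => n; rewrite qpow1 ?mulr1.
Qed.

(** Telescoping. Applied to [fquot], this is the expansion of g_n over indices i <= n, and
    [series_antidiff_up] the one over i > n. *)
Lemma series_antidiff_down (g : int -> C) n :
  abs_cvg N (fun n : nat => g (- n%:Z)) 0 ->
  abs_cvg N (series (fun k : nat => g (n - k%:Z) - g (n - k%:Z - 1))) (g n).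
Proof.
move=> /(abs_cvgP N_abs) g0; apply/(abs_cvgP N_abs) => e /g0[k0 Hk0].
(* Adding |n| ensures k - n >= k0. *)
exists (k0 + `|n|)%N => k kk0.
have -> : series (fun k : nat => g (n - k%:Z) - g (n - k%:Z - 1)) k = g n - g (n - k%:Z).
  rewrite /series /=; elim: k {kk0} => [|k IH]; first by rewrite big_geq // subr0 subrr.
  rewrite big_nat_recr //= IH; have -> : n - k.+1%:Z = n - k%:Z - 1 by lia.
  by ring.
have -> : n - k%:Z = - (`|k%:Z - n|%N)%:Z by lia.
have := Hk0 `|k%:Z - n|%N; rewrite subr0 addrAC subrr add0r nabsN //; apply.
by lia.
Qed.

Lemma series_antidiff_up (g : int -> C) n :
  abs_cvg N (fun n : nat => g n%:Z) 0 ->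
  abs_cvg N (series (fun k : nat => g (n + 1 + k%:Z) - g (n + 1 + k%:Z - 1))) (- g n).
Proof.
move=> /(abs_cvgP N_abs) g0; apply/(abs_cvgP N_abs) => e /g0[k0 Hk0].
exists (k0 + `|n|)%N => k kk0.
have -> : series (fun k : nat => g (n + 1 + k%:Z) - g (n + 1 + k%:Z - 1)) k =
    g (n + k%:Z) - g n.
  rewrite /series /=; elim: k {kk0} => [|k IH]; first by rewrite big_geq // addr0 subrr.
  rewrite big_nat_recr //= IH.
  have -> : n + 1 + k%:Z - 1 = n + k%:Z by lia.
  have -> : n + k.+1%:Z = n + 1 + k%:Z by lia.
  by ring.
have -> : n + k%:Z = (`|(k%:Z + n)%R|%N)%:Z by lia.
have := Hk0 `|(k%:Z + n)%R|%N; rewrite subr0 opprK subrK; apply.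
by lia.
Qed.

Lemma zsums_to0_antidiff (d : int -> C) : zsums_to N d 0 ->
  exists g : int -> C, (forall n, g n - g (n - 1) = d n) /\
    abs_cvg N (fun n : nat => g n%:Z) 0 /\ abs_cvg N (fun n : nat => g (- n%:Z)) 0.
Proof.
move=> [l1 [l2 [dl1 dl2 l120]]].
(* [g n] is the sum of [d i] over i <= n, with [l2] the sum over negative indices. It tends to l1 +
   l2 = 0 at the upper end and to l2 - l2 = 0 at the lower one. *)
pose g (n : int) := match n with
  | Posz m => l2 + series (fun k : nat => d k%:Z) m.+1
  | Negz m => l2 - series (fun k : nat => d (- k.+1%:Z)) m end.
exists g; split; last split.
- case=> [[|m]|m].
  + by rewrite (_ : 0%N%:Z - 1 = Negz 0) // /g /series /= big_nat1 big_geq //; ring.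
  + rewrite (_ : m.+1%:Z - 1 = m%:Z); last by lia.
    by rewrite /g [series _ m.+2]seriesSr; ring.
  + rewrite (_ : Negz m - 1 = Negz m.+1); last by lia.
    by rewrite /g [series _ m.+1]seriesSr NegzE; ring.
- have := abs_cvgD N_abs (abs_cvg_cst N_abs l2) (iffRL (abs_cvg_shift N_abs _ _ 1) dl1).
  by rewrite addrC -l120; apply: eq_abs_cvg => n; rewrite addn1.
- apply/(abs_cvg_shift N_abs _ _ 1).
  have := abs_cvgD N_abs (abs_cvg_cst N_abs l2) (abs_cvgN N_abs dl2).
  by rewrite subrr; apply: eq_abs_cvg => n; rewrite addn1 -NegzE.
Qed.

(** As f(alpha) = 0, the required differences sum to 0 and [zsums_to0_antidiff] provides g;
    convergence of g(z) is then checked at each end. *)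
Lemma fquot_exists (f : int -> C) alpha : calF N q f -> fker N q f alpha ->
  exists g : int -> C, calF N q g /\ forall n, g n - g (n - 1) = f n * qpow q n alpha.
Proof.
move=> fF fa.
have [l fl] := fF alpha.
have l0 : l = 0 by move: fa; rewrite /fker /= /feval (zsumE N_abs fl).
rewrite l0 in fl; have [g [gd [g_up g_down]]] := zsums_to0_antidiff fl.
exists g; split=> // z; apply: null_zsums_to => //.
  (* Upper end: g_n is expanded over indices j > n. A term f_j alpha^(q^j) z^(q^n) is bounded by the
     j-th term of f(alpha) if |z| <= 1, and by that of f(alpha z) otherwise. *)
  have [/(abs_cvgP N_abs) fa0 _] := zsums_to_null N_abs fl.
  have [l' /(zsums_to_null N_abs)[/(abs_cvgP N_abs) faz0 _]] := fF (alpha * z).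
  apply/(abs_cvgP N_abs) => e e0.
  have [k Hk] := fa0 e e0; have [k' Hk'] := faz0 e e0.
  exists (maxn k k') => n; rewrite geq_max => /andP[kn k'n]; rewrite subr0.
  have := abs_cvgMr N_abs (qpow q n%:Z z) (series_antidiff_up n%:Z g_up).
  rewrite mulNr => /(abs_cvgN N_abs); rewrite opprK => /abs_cvg_le; apply=> //.
  exists 0%N => m _; rewrite nabsN // /series /= mulr_suml.
  apply: nabs_sum_le => [//||i _]; first exact: ltW.
  rewrite gd; have -> : n%:Z + 1 + i%:Z = (n + 1 + i)%N%:Z by lia.
  move: (n + 1 + i)%N (leq_trans (leq_addr 1 n) (leq_addr i _)) => j nj.
  rewrite nabsM // [N (qpow q n _)]nabsX //.
  have [z1|/ltW z1] := leP (N z) 1.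
    apply: le_trans (_ : N (f j * qpow q j alpha) <= e).
      by rewrite ler_piMr ?nabs_ge0 // exprn_ile1 // nabs_ge0.
    by have := Hk j (leq_trans kn nj); rewrite subr0.
  have := Hk' j (leq_trans k'n nj); rewrite subr0 qpowM // mulrA nabsM //.
  apply: le_trans; apply: ler_wpM2l; first exact: nabs_ge0.
  by rewrite /= nabsX // ler_weXn2l // leq_pexp2l // ltnW.
(* Lower end: the iterated roots of z stay bounded by max(1, |z|), while g tends to 0. *)
move/(abs_cvgP N_abs): g_down => g_down; apply/(abs_cvgP N_abs) => e e0.
have M0 : 0 < Num.max 1 (N z) by rewrite lt_max ltr01.
have [k Hk] := g_down _ (divr_gt0 e0 M0); exists k => n /Hk.
rewrite !subr0 ler_pdivlMr // nabsM //; apply: le_trans.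
by apply: ler_wpM2l; rewrite ?nabs_ge0 // nabs_qroot_le.
Qed.

(* Uniqueness of the quotient is not an issue: any [g] in [calF] with these
   differences tends to 0 at both ends, so telescoping determines it. *)
Lemma fquotP (f : int -> C) alpha : calF N q f -> fker N q f alpha ->
  calF N q (fquot N q f alpha) /\ forall n,
    fquot N q f alpha n - fquot N q f alpha (n - 1) = f n * qpow q n alpha.
Proof.
move=> fF fa; have [g [gF gd]] := fquot_exists fF fa.
have : exists g, calF N q g /\
    fcomp N q f (fconst alpha) = fcomp N q g (fconst 1 \- @ftau C).
  exists g; split=> //.
  by rewrite (fcomp_fconst q_gt1) // (fcomp_1subtau q_gt1) //; apply/funext.
move=> /(xgetPex (fun=> 0)) []; rewrite -/(fquot N q f alpha) => hF.
rewrite (fcomp_fconst q_gt1) // (fcomp_1subtau q_gt1) // => hd.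
by split=> // n; rewrite -(congr1 (fun h : int -> C => h n) hd).
Qed.

(** Convergence of f at a point of absolute value at least b max(1, c) / d absorbs all three
    constants. *)
Lemma calF_small (f : int -> C) (b c d : R) : calF N q f -> 0 <= b -> 0 <= c -> 0 < d ->
  exists K : nat, forall i : nat, (K <= i)%N ->
    N (f i%:Z) * b ^+ (q ^ i) * c <= d ^+ (q ^ i).
Proof.
move=> fF b0 c0 d0.
(* If no absolute value exceeds 1, then N is trivial and f is eventually 0. *)
have [[z z1]|triv] := pselect (exists z, 1 < N z).
  have [k zk] := expr_unbounded (b * Num.max 1 c / d) z1.
  rewrite ler_pdivrMr // -nabsX // in zk.
  have [l /(zsums_to_null N_abs)[/(abs_cvgP N_abs) fz _]] := fF (z ^+ k).
  have [K HK] := fz 1 ltr01; exists K => i /HK; rewrite subr0 nabsM //= nabsX // => fi1.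
  apply: le_trans (_ : N (f i%:Z) * (N (z ^+ k) * d) ^+ (q ^ i) <= _).
    rewrite -mulrA ler_wpM2l ?nabs_ge0 //.
    have c1 : c <= Num.max 1 c ^+ (q ^ i).
      apply: le_trans (_ : Num.max 1 c <= _); first by rewrite le_max lexx orbT.
      by rewrite ler_eXnr ?expq_gt0 // le_max lexx.
    apply: le_trans (_ : (b * Num.max 1 c) ^+ (q ^ i) <= _).
      by rewrite exprMn ler_wpM2l // exprn_ge0.
    by rewrite lerXn2r // ?nnegrE ?mulr_ge0 ?(nabs_ge0 N_abs) ?le_max ?ler01 ?(ltW d0).
  by rewrite exprMn mulrA ler_piMl // exprn_ge0 // ltW.
have [/(abs_cvgP N_abs) f0 _] := calF_null fF.
have h0 : 0 < 2^-1 :> R by rewrite invr_gt0.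
have [K HK] := f0 _ h0; exists K => i /HK; rewrite subr0 => fi.
suff -> : f i%:Z = 0 by rewrite nabs0 // !mul0r exprn_ge0 // ltW.
(* A nonzero coefficient of absolute value at most 1/2 would have an inverse of absolute value at
   least 2. *)
apply/eqP/negPn/negP => fi0; apply: triv; exists (f i%:Z)^-1.
have := nabsM N_abs (f i%:Z) (f i%:Z)^-1; rewrite divff // nabs1 // => fV.
have := nabs_ge0 N_abs (f i%:Z)^-1; nra.
Qed.

(* The terms of [- (g_n beta)^(q^-n)], where [- g_n] is expanded over the indices
   [n + 1 + l], [l >= 0]. *)
Definition tail_term (f : int -> C) (alpha beta : C) (n l : nat) : C :=
  qpow q (- n%:Z) (f (n%:Z + 1 + l%:Z) * qpow q (n%:Z + 1 + l%:Z) alpha * beta).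

(** The joint decay required by [series_fubini]. Before the q^n-th root is taken the term is at most
    d^(q^(n+l+1)) with d = min(1, e), hence at most d^(q^n). *)
Lemma tail_term_small (f : int -> C) alpha beta e : calF N q f -> 0 < e ->
  exists K : nat, forall n l, (K <= n + l)%N -> N (tail_term f alpha beta n l) <= e.
Proof.
move=> fF e0; pose d := Num.min 1 e.
have d0 : 0 < d by rewrite lt_min ltr01.
have [K HK] := calF_small fF (nabs_ge0 N_abs alpha) (nabs_ge0 N_abs beta) d0.
exists K => n l Knl.
rewrite /tail_term; have -> : n%:Z + 1 + l%:Z = (n + l).+1%:Z by lia.
have := HK (n + l).+1 (leqW Knl); rewrite -nabsX // -!nabsM //.
set x := _ * beta => xd; apply: le_trans (_ : d <= _); last by rewrite ge_min lexx orbT.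
rewrite -(@ler_pXn2r _ (q ^ n)) ?expq_gt0 ?nnegrE ?(nabs_ge0 N_abs) ?(ltW d0) //.
have nE : - n%:Z = 0%N%:Z - n%:Z by lia.
rewrite (nabs_qpow q_gt1 q_pchar N_abs _ nE) expn0 expr1; apply: le_trans xd _.
rewrite ler_wiXn2l ?(ltW d0) //; first by rewrite ge_min lexx.
by rewrite leq_pexp2l ?(ltnW q_gt1) // -addnS leq_addr.
Qed.

(** With m = n + 1 + l, the hypothesis reads f_m = - (f_(-m))^(q^m). Raising to q^(l+1) turns
    alpha^(q^-m) into alpha^(q^-n) and beta into beta^(q^(l+1)), so alpha and beta exchange
    roles. *)
Lemma tail_term_adj (f : int -> C) alpha beta (n l : nat) : fadj q f = \- f ->
  qpow q l.+1%:Z (f (- l.+1%:Z - n%:Z) * qpow q (- l.+1%:Z - n%:Z) alpha * beta) =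
  - tail_term f beta alpha n l.
Proof.
move=> f_adj; rewrite /tail_term.
have fE : f (n%:Z + 1 + l%:Z) = - qpow q (n%:Z + 1 + l%:Z) (f (- l.+1%:Z - n%:Z)).
  have := congr1 (fun h : int -> C => h (n%:Z + 1 + l%:Z)) f_adj; rewrite /fadj /= => fE.
  have -> : - l.+1%:Z - n%:Z = - (n%:Z + 1 + l%:Z) by lia.
  by rewrite fE opprK.
rewrite fE !mulNr qpowN // opprK -qpowM // !qpowM // !qpow_qpow //.
have -> : - n%:Z + (n%:Z + 1 + l%:Z) = l.+1%:Z by lia.
have -> : l.+1%:Z + (- l.+1%:Z - n%:Z) = - n%:Z by lia.
by rewrite mulrAC.
Qed.

(** * Exchange of summations and symmetry *)

Section Symmetry.
Context {f : int -> C} (fF : calF N q f) (f_adj : fadj q f = \- f).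

(** Indexed as in the adjoint: m is minus the index of the coefficient of g_alpha, so m <= 0 is the
    part n >= 0. *)
Definition pairing_term (alpha beta : C) (m : int) : C :=
  qpow q m (fquot N q f alpha (- m) * beta).

(** Row n of the array for (alpha, beta), from the expansion of g_n over i > n, whose sum is -
    g_n. *)
Lemma pairing_term_nonpos alpha beta (n : nat) : fker N q f alpha ->
  abs_cvg N (series (tail_term f alpha beta n)) (- pairing_term alpha beta (- n%:Z)).
Proof.
move=> fa; have [gF gd] := fquotP fF fa; have [g_up _] := calF_null gF.
have := abs_cvg_qpow q_gt1 q_pchar N_abs (- n%:Z)
  (abs_cvgMr N_abs beta (series_antidiff_up n%:Z g_up)).
rewrite mulNr qpowN // /pairing_term opprK; apply: eq_abs_cvg => m.
rewrite seriesMr qpow_series //; apply: eq_bigr => i _.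
by rewrite gd.
Qed.

(** Column l of the array for (beta, alpha), from the expansion of g_(-(l+1)) over lower indices;
    the sign comes from [tail_term_adj]. *)
Lemma pairing_term_pos alpha beta (l : nat) : fker N q f alpha ->
  abs_cvg N (series (fun n => tail_term f beta alpha n l))
    (- pairing_term alpha beta l.+1%:Z).
Proof.
move=> fa; have [gF gd] := fquotP fF fa; have [_ g_down] := calF_null gF.
have := abs_cvgN N_abs (abs_cvg_qpow q_gt1 q_pchar N_abs l.+1%:Z
  (abs_cvgMr N_abs beta (series_antidiff_down (- l.+1%:Z) g_down))).
apply: eq_abs_cvg => m.
rewrite seriesMr qpow_series // /series -sumrN; apply: eq_bigr => i _.
by rewrite gd tail_term_adj // opprK.
Qed.

Lemma pairing_half alpha beta : fker N q f alpha -> fker N q f beta ->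
  exists s, abs_cvg N (series (fun n : nat => pairing_term alpha beta (- n%:Z))) s /\
    abs_cvg N (series (fun l : nat => pairing_term beta alpha l.+1%:Z)) s.
Proof.
move=> fa fb.
have [|||s [s1 s2]] := @series_fubini _ _ _ N_abs N_complete (tail_term f alpha beta)
  (fun n : nat => - pairing_term alpha beta (- n%:Z))
  (fun l : nat => - pairing_term beta alpha l.+1%:Z).
- by move=> e; exact: tail_term_small.
- by move=> n; exact: pairing_term_nonpos.
- by move=> l; exact: pairing_term_pos.
exists (- s); split; [move: s1 | move: s2] => /(abs_cvgN N_abs);
  by apply: eq_abs_cvg => n; rewrite /series /= sumrN opprK.
Qed.

Lemma fpairing_sym alpha beta : fker N q f alpha -> fker N q f beta ->
  fpairing N q f alpha beta = fpairing N q f beta alpha.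
Proof.
move=> fa fb.
(* Each half of one pairing equals the opposite half of the other, so both pairings are s + t. *)
have [s [ab_down ba_up]] := pairing_half fa fb.
have [t [ba_down ab_up]] := pairing_half fb fa.
have pairE x y : fpairing N q f x y = zsum N (pairing_term x y).
  by congr zsum; apply/funext => m; rewrite /pairing_term qpowM.
rewrite !pairE (zsumE N_abs (zsums_to_shift N_abs ab_up ab_down)).
by rewrite (zsumE N_abs (zsums_to_shift N_abs ba_up ba_down)) addrC.
Qed.

End Symmetry.
End Pairing.

Theorem theorem8p11 (p q : nat) (p_prime : prime p)
    (q_pow : exists2 k : nat, (0 < k)%N & q = (p ^ k)%N)
    (Fq : finFieldType) (card_Fq : #|Fq| = q)
    (C : closedFieldType) (iota : {rmorphism Fq -> C})
    (R : realType) (N : C -> R) (N_abs : nonarch_abs N)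
    (N_complete : abs_complete N)
    (f : int -> C) (fF : calF N q f) (f_neq0 : f <> (fun=> 0))
    (f_adj : fadj q f = \- f) :
  forall alpha beta : C, fker N q f alpha -> fker N q f beta ->
    fpairing N q f alpha beta = fpairing N q f beta alpha.
Proof.
have [k k_gt0 qE] := q_pow.
(* [Fq] has p^k elements, hence characteristic p, which [iota] carries to [C]. *)
have pC : p \in [pchar C].
  by apply: (rmorph_pchar iota); apply: (@card_finPcharP _ _ k); rewrite // card_Fq.
move=> alpha beta; apply: fpairing_sym => //.
  by rewrite qE -(exp1n k) ltn_exp2r // prime_gt1.
by rewrite qE pnatX pnatE // pC.
Qed.
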